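(* Given a simple cut-set $A^k\subset A$ of the network $G=(V,A)$, the Benders cut $$\theta \le \sum_{a\in A^k}\mathrm{Cap}_a\, y_a = \bar\theta^k(y)$$ is Pareto-optimal.
   Context: Network: $G=(V,A)$, where $V$ is the set of nodes and $A\subseteq V\times V$ is the set of directed arcs; arc $a$ has capacity $\mathrm{Cap}_a$. There is exactly one source and one sink, and a directed arc $0\in A$ from the sink to the source, which measures the total flow and whose capacity is sufficiently high that it does not restrict flow through the network. For a node $v$, $\delta^-(v)$ and $\delta^+(v)$ are the sets of arcs entering and leaving $v$. Cut-sets: A cut-set is a set of arcs which, when removed, prevents all flow from the source to the sink, i.e. no complete forward path from source to sink remains. A simple cut-set is a cut-set which would no longer be a cut-set if any arc was omitted from it. Scheduling (master) problem: $T$ is a set of time periods, $R$ a set of maintenance requests, and $R_a\subseteq R$ the requests to be performed on arc $a$. Request $r$ has duration $\mathrm{Dur}_r$, release time $\mathrm{Re}_r$ and deadline $\mathrm{De}_r$. The variable $y_{at}\in\{0,1\}$ is 1 if arc $a$ is operational (open) at time $t$ and 0 if it is undergoing maintenance (closed); $\mathrm{Start}_{rt}\in\{0,1\}$ is 1 if request $r$ starts at time $t$ and 0 otherwise. The scheduling constraints are $$\sum_{t=\mathrm{Re}_r}^{\mathrm{De}_r-\mathrm{Dur}_r+1}\mathrm{Start}_{rt}=1\quad\text{for all } r\in R,$$ $$y_{at}+\sum_{r\in R_a}\ \sum_{t'=\max\{\mathrm{Re}_r,\,t-\mathrm{Dur}_r+1\}}^{\min\{t,\,\mathrm{De}_r\}}\mathrm{Start}_{rt'}=1\quad\text{for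 all } a\in A,\ t\in T.$$ The master problem maximises $\sum_{t\in T}\theta_t$ subject to these constraints and to Benders cuts, where $\theta_t\ge 0$ approximates the maximum flow at time $t$. The cuts are separate for each time period, so one period is considered and the index $t$ is omitted, writing $\theta$, $x_a$, $y_a$, $u_a$ for $\theta_t$, $x_{at}$, $y_{at}$, $u_{at}$. A feasible $y=(y_a)_{a\in A}$ is a configuration of the arcs in that period that occurs in a feasible solution of the master problem. Sub-problem: for a given configuration $y^*$, maximise $x_0$ subject to $\sum_{a\in\delta^-(v)}x_a-\sum_{a\in\delta^+(v)}x_a=0$ for all $v\in V$, $x_a\le\mathrm{Cap}_a y^*_a$ for all $a\in A$, and $x_a\ge0$ for all $a\in A$, where $x_a$ is the flow over arc $a$. Let $u_a$ be the dual variable associated with the capacity constraint $x_a\le\mathrm{Cap}_a y^*_a$; the dual problem minimises $\sum_{a\in A}\mathrm{Cap}_a y^*_a u_a$. Benders cuts: a Benders cut has the form $\theta\le\bar\theta^l(y)$ with $\bar\theta^l(y)=\sum_{a\in A}\mathrm{Cap}_a\,y_a u^l_a$, where $u^l$ is the vector of capacity-constraint dual variables from solving a sub-problem. The Benders cut generated by a simple cut-set $A^k$ is the one with $A^k=\{a\in A: u^k_a>0\}=\{a\in A:u^k_a=1\}$. Domination: a Benders cut $\theta\le\bar\theta^k(y)$ dominates another Benders cut $\theta\le\bar\theta^l(y)$ if $\bar\theta^k(y)\le\bar\theta^l(y)$ for all feasible $y$, with strict inequality for at least one feasible $y$. A Benders cut is Pareto-optimal if it is not dominated by any other cut.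
   Formalization: Two assumptions are added, without which the claim fails: all arc capacities are strictly positive, and for every arc b outside A^k some feasible y for the period closes all arcs of A^k while leaving b open. *)

(* Defs.v *)
From mathcomp Require Import all_boot all_order all_algebra.
Set Implicit Arguments.
Unset Strict Implicit.
Unset Printing Implicit Defensive.
Import Order.TTheory GRing.Theory Num.Theory.
Local Open Scope ring_scope.

(* Arcs are ordered pairs of nodes, so arc vectors (flows, capacities, duals,
   configurations) are functions on V * V of which only the values on the arc
   set are ever used. *)

(* Net inflow zero at every node. *)
Definition conserved (R : realFieldType) (V : finType) (A : {set V * V})
    (x : V * V -> R) : Prop :=
  forall v : V,
    \sum_(a in A | a.2 == v) x a - \sum_(a in A | a.1 == v) x a = 0.

(* The return arc, written 0 in the usual notation, is the pair (sink, source).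
   net_return_cap says that its capacity never restricts the flow: it is
   respected by every flow that respects the capacities of the other arcs. *)
Record network (R : realFieldType) := Network {
  node : finType;
  arcs : {set node * node};
  source : node;
  sink : node;
  cap : node * node -> R;
  net_source_sink : source != sink;
  net_return_arc : (sink, source) \in arcs;
  net_cap_gt0 : forall a, a \in arcs -> 0 < cap a;
  net_return_cap : forall x : node * node -> R,
    conserved arcs x ->
    (forall a, a \in arcs -> 0 <= x a) ->
    (forall a, a \in arcs -> a != (sink, source) -> x a <= cap a) ->
    x (sink, source) <= cap (sink, source)
}.

Definition net_arc (R : realFieldType) (N : network R) : finType :=
  (node N * node N)%type.

Definition return_arc (R : realFieldType) (N : network R) : net_arc N :=
  (sink N, source N).

(* true = open (operational), false = closed (under maintenance) *)
Definition config (R : realFieldType) (N : network R) : Type :=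
  net_arc N -> bool.

Definition cutset (R : realFieldType) (N : network R)
    (S : {set net_arc N}) : bool :=
  (S \subset arcs N) &&
  ~~ connect (fun v w => (v, w) \in arcs N :\: S) (source N) (sink N).

Definition simple_cutset (R : realFieldType) (N : network R)
    (S : {set net_arc N}) : Prop :=
  cutset S /\ forall a, a \in S -> ~~ cutset (S :\ a).

(* Right-hand side of the cut with coefficient vector u; as a function of u for
   fixed y it is also the objective of the dual sub-problem. *)
Definition benders_bound (R : realFieldType) (N : network R)
    (u : net_arc N -> R) (y : config N) : R :=
  \sum_(a in arcs N) cap a * (y a)%:R * u a.

(* LP dual of the sub-problem
     max x_0  s.t.  inflow - outflow = 0 at each node v      (dual p v, free),
                    x_a <= Cap_a y_a   for each arc a        (dual u a >= 0),
                    x >= 0.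
   The column of x_a for a = (i, j) has +1 in row j, -1 in row i and 1 in its
   own capacity row; its objective coefficient is 1 iff a is the return arc. *)
Definition dual_feasible (R : realFieldType) (N : network R)
    (p : node N -> R) (u : net_arc N -> R) : Prop :=
  (forall a, a \in arcs N -> 0 <= u a) /\
  (forall a, a \in arcs N -> (a == return_arc N)%:R <= p a.2 - p a.1 + u a).

Definition dual_optimal (R : realFieldType) (N : network R)
    (y : config N) (p : node N -> R) (u : net_arc N -> R) : Prop :=
  dual_feasible p u /\
  forall p' u', dual_feasible p' u' -> benders_bound u y <= benders_bound u' y.

(* u is the vector of capacity duals obtained from some sub-problem, i.e.
   theta <= benders_bound u y is a Benders cut. *)
Definition benders_vector (R : realFieldType) (N : network R)
    (u : net_arc N -> R) : Prop :=
  exists (y : config N) (p : node N -> R), dual_optimal y p u.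

Record schedule_data (R : realFieldType) (N : network R) := ScheduleData {
  periods : seq nat;
  request : finType;
  requests_on : net_arc N -> {set request};
  duration : request -> nat;
  release : request -> nat;
  deadline : request -> nat
}.

(* Sums over integer intervals are written with exclusive upper bounds, so that
   truncated subtraction on nat never adds or removes a term. *)
Definition master_feasible (R : realFieldType) (N : network R)
    (M : schedule_data N) (y : nat -> config N)
    (start : request M -> nat -> bool) (theta : nat -> R) : Prop :=
  [/\ forall r : request M,
        (\sum_(release r <= t < (deadline r).+2 - duration r) start r t = 1)%N,
      forall a t, a \in arcs N -> t \in periods M ->
        (y t a + \sum_(r in requests_on M a)
           \sum_(maxn (release r) (t.+1 - duration r) <= t'
                   < (minn t (deadline r)).+1) start r t' = 1)%N,
      forall t, t \in periods M -> 0 <= theta t &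
      forall t u, t \in periods M -> benders_vector u ->
        theta t <= benders_bound u (y t)].

Definition feasible_config (R : realFieldType) (N : network R)
    (M : schedule_data N) (t : nat) (y : config N) : Prop :=
  exists (ys : nat -> config N) (start : request M -> nat -> bool)
         (theta : nat -> R),
    master_feasible ys start theta /\ {in arcs N, ys t =1 y}.

Definition dominates (R : realFieldType) (N : network R)
    (M : schedule_data N) (t : nat) (uk ul : net_arc N -> R) : Prop :=
  (forall y, feasible_config M t y -> benders_bound uk y <= benders_bound ul y) /\
  (exists y, feasible_config M t y /\ benders_bound uk y < benders_bound ul y).

Definition pareto_optimal (R : realFieldType) (N : network R)
    (M : schedule_data N) (t : nat) (u : net_arc N -> R) : Prop :=
  benders_vector u /\ forall ul, benders_vector ul -> ~ dominates M t ul u.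

(* The arcs of S can be closed together in period t without this forcing any
   particular further arc to be closed as well.  Arbitrary schedule data need
   not satisfy this: on a path of two arcs of equal capacity, of which only the
   first is ever maintained, the cut y_1 dominates the cut y_2. *)
Definition closable (R : realFieldType) (N : network R)
    (M : schedule_data N) (t : nat) (S : {set net_arc N}) : Prop :=
  forall b, b \in arcs N -> b \notin S ->
    exists y, [/\ feasible_config M t y, forall a, a \in S -> ~~ y a & y b].

(* Main.v *)
Require Import Defs.
From mathcomp Require Import all_boot all_order all_algebra.
From mathcomp Require Import lra.
Set Implicit Arguments.
Unset Strict Implicit.
Unset Printing Implicit Defensive.
Import Order.TTheory GRing.Theory Num.Theory.
Local Open Scope ring_scope.

(** Let [W] be the set of nodes reachable from the source once the simple
    cut-set [S] is removed.  By minimality [S] is exactly the set of arcs leaving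
    [W], so the indicators of [W] and [S] form a dual solution, optimal for the
    configuration that closes exactly [S].  A cut [u] dominating it must vanish
    on every configuration closing [S], hence [u] is supported on [S].  Each [a]
    in [S] lies on a source-sink path meeting [S] only in [a]; summing the dual
    constraints along that path and the return arc gives [1 <= u a], so [u] is
    nowhere smaller than the given cut. *)

(** Cut a path before its first and after its last use of the added arc. *)
Lemma connect_add_arc (T : finType) (e : rel T) (i j x y : T) :
  connect (fun v w => e v w || ((v, w) == (i, j))) x y ->
  connect e x y || connect e x i && connect e j y.
Proof.
case/connectP=> p; elim: p x => [|z p IHp] x /=.
  by move=> _ ->; rewrite connect0.
case/andP=> exz pz y_last; have := IHp _ pz y_last.
case/orP: exz => [/connect1 xz | /eqP[-> ->]]; last first.
  by rewrite connect0; case/orP=> [-> | /andP[_ ->]]; rewrite ?orbT.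
case/orP=> [zy | /andP[zi ->]]; first by rewrite (connect_trans xz zy).
by rewrite (connect_trans xz zi) orbT.
Qed.

Lemma benders_bound_ge0 (R : realFieldType) (N : network R)
    (u : net_arc N -> R) (y : config N) :
  (forall a, a \in arcs N -> 0 <= u a) -> 0 <= benders_bound u y.
Proof.
move=> u_ge0; apply: sumr_ge0 => a aA.
by rewrite !mulr_ge0 ?ler0n ?u_ge0 // ltW // net_cap_gt0.
Qed.

Lemma benders_bound_le0_coef0 (R : realFieldType) (N : network R)
    (u : net_arc N -> R) (y : config N) b :
  (forall a, a \in arcs N -> 0 <= u a) -> benders_bound u y <= 0 ->
  b \in arcs N -> y b -> u b = 0.
Proof.
move=> u_ge0 le0 bA yb.
have term_ge0 a : a \in arcs N -> 0 <= cap a * (y a)%:R * u a.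
  by move=> aA; rewrite !mulr_ge0 ?ler0n ?u_ge0 // ltW // net_cap_gt0.
have /eqP : benders_bound u y = 0.
  by apply/eqP; rewrite eq_le le0 benders_bound_ge0.
rewrite psumr_eq0 // => /allP/(_ b (mem_index_enum b)).
by rewrite bA yb mulr1 mulf_eq0 (gt_eqF (net_cap_gt0 bA)) => /eqP.
Qed.

Section SimpleCutset.

Variables (R : realFieldType) (N : network R) (S : {set net_arc N}).
Hypothesis simpleS : simple_cutset S.

Let open_rel : rel (node N) := fun v w => (v, w) \in arcs N :\: S.

Let sourceside : pred (node N) := connect open_rel (source N).

Lemma simple_cutset_sub : S \subset arcs N.
Proof. by case: simpleS => /andP[]. Qed.

Lemma simple_cutset_disconnects : ~~ connect open_rel (source N) (sink N).
Proof. by case: simpleS => /andP[]. Qed.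

(** By minimality, putting [a] back restores a source-sink path; since [S] separates, this path must
    traverse [a]. *)
Lemma simple_cutset_connect a : a \in S ->
  connect open_rel (source N) a.1 && connect open_rel a.2 (sink N).
Proof.
move=> aS; case: simpleS => _ /(_ a aS).
rewrite /cutset (subset_trans (subD1set _ _) simple_cutset_sub) /= negbK => st.
have := @connect_add_arc _ open_rel a.1 a.2 (source N) (sink N).
rewrite (negPf simple_cutset_disconnects); apply.
move: st; apply: connect_sub => v w.
rewrite !inE => vw; apply: connect1; rewrite /open_rel !inE -surjective_pairing.
by case: eqP vw => [->|_]; rewrite ?orbT //= orbF.
Qed.

(** The return arc starts at the sink, whereas tails of arcs in [S] are reachable from the
    source. *)
Lemma return_arc_notin_simple_cutset : return_arc N \notin S.
Proof.
apply/negP => /simple_cutset_connect /andP[st _].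
by have := simple_cutset_disconnects; rewrite st.
Qed.

Lemma simple_cutset_boundary a : a \in arcs N ->
  (a \in S) = sourceside a.1 && ~~ sourceside a.2.
Proof.
move=> aA; rewrite /sourceside; apply/idP/andP => [aS | [s1 s2]].
  have /andP[s1 t2] := simple_cutset_connect aS; split=> //.
  apply: contra simple_cutset_disconnects => s2.
  exact: connect_trans s2 t2.
apply: contraR s2 => aS; apply: connect_trans s1 (connect1 _).
by rewrite /open_rel -surjective_pairing inE aS aA.
Qed.

(** The potential rises by 1 along the return arc and drops only along arcs of [S], where the unit
    capacity dual pays for the drop. *)
Lemma simple_cutset_dual_feasible :
  dual_feasible (fun v => (sourceside v)%:R : R)
                (fun a : net_arc N => (a \in S)%:R).
Proof.
split=> [a _ | a aA]; first exact: ler0n.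
have [-> | _] := eqVneq a (return_arc N).
  rewrite (negPf return_arc_notin_simple_cutset) /= /sourceside connect0.
  by rewrite (negPf simple_cutset_disconnects) subr0 addr0.
rewrite (simple_cutset_boundary aA).
by case: (sourceside a.1); case: (sourceside a.2);
  rewrite ?subrr ?sub0r ?subr0 ?addr0 ?addNr ?ler01.
Qed.

Lemma benders_bound_indicator (y : config N) :
  benders_bound (fun a => (a \in S)%:R) y = \sum_(a in S) cap a * (y a)%:R.
Proof.
rewrite /benders_bound [LHS](big_setID S) /= (setIidPr simple_cutset_sub).
rewrite [X in _ + X]big1 ?addr0 => [|a]; last first.
  by rewrite inE => /andP[/negPf-> _]; rewrite mulr0.
by apply: eq_bigr => a ->; rewrite mulr1.
Qed.

Lemma simple_cutset_benders_vector :
  benders_vector (fun a : net_arc N => (a \in S)%:R : R).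
Proof.
(* Closing exactly [S] brings the objective down to 0, a lower bound for every dual feasible
   solution. *)
exists (fun a => a \notin S), (fun v => (sourceside v)%:R).
split=> [|p' u' [u'_ge0 _]]; first exact: simple_cutset_dual_feasible.
rewrite benders_bound_indicator big1 ?benders_bound_ge0 // => a ->.
by rewrite mulr0.
Qed.

Lemma dual_feasible_ge1 p u : dual_feasible p u ->
  (forall b, b \in arcs N -> b \notin S -> u b = 0) ->
  forall a, a \in S -> 1 <= u a.
Proof.
move=> [_ feas] u0 a aS.
(* Where [u] vanishes, the dual constraints say that [p] does not decrease along an arc. *)
have p_connect v w : connect open_rel v w -> p v <= p w.
  case/connectP=> q; elim: q v => [|z q IHq] v /=; first by move=> _ ->.
  case/andP=> /setDP[vzA vzS] /IHq zw /zw; apply: le_trans.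
  rewrite -subr_ge0; have := feas _ vzA; rewrite (u0 _ vzA vzS) addr0.
  by apply: le_trans; exact: ler0n.
have /andP[/p_connect sa /p_connect at_] := simple_cutset_connect aS.
have aA := subsetP simple_cutset_sub a aS.
have retA := net_return_arc N.
have := feas _ retA.
rewrite (u0 _ retA return_arc_notin_simple_cutset) eqxx addr0 /= => ret.
have arc_a : 0 <= p a.2 - p a.1 + u a.
  by apply: le_trans (feas _ aA); exact: ler0n.
(* [u a >= p a.1 - p a.2 >= p (source N) - p (sink N) >= 1]. *)
lra.
Qed.

End SimpleCutset.

Theorem theorem2 (R : realFieldType) (N : network R) (M : schedule_data N)
    (t : nat) (ht : t \in periods M)
    (Ak : {set net_arc N}) (hAk : simple_cutset Ak) (hM : closable M t Ak) :
  exists uk : net_arc N -> R,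
    [/\ benders_vector uk,
        [set a in arcs N | 0 < uk a] = Ak,
        [set a in arcs N | uk a == 1] = Ak,
        forall y : config N,
          benders_bound uk y = \sum_(a in Ak) cap a * (y a)%:R
      & pareto_optimal M t uk].
Proof.
have AkA := setIidPr (simple_cutset_sub hAk).
have bv := simple_cutset_benders_vector hAk.
exists (fun a => (a \in Ak)%:R); split=> //.
- by rewrite -[RHS]AkA; apply/setP => a; rewrite !inE ltr0n lt0b.
- by rewrite -[RHS]AkA; apply/setP => a; rewrite !inE pnatr_eq1 eqb1.
- exact: benders_bound_indicator hAk.
split=> // u [y0 [p [feas _]]] [le_u [y [_ lt_u]]].
have u_ge0 := feas.1.
have u0 b : b \in arcs N -> b \notin Ak -> u b = 0.
  (* In [z] all of [Ak] is closed, so the given cut is 0 there and domination forces the bound of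
     [u] to be at most 0, although [b] is open. *)
  move=> bA bAk; have [z [zfeas zAk zb]] := hM b bA bAk.
  apply: (benders_bound_le0_coef0 u_ge0 _ bA zb); apply: le_trans (le_u z zfeas) _.
  rewrite benders_bound_indicator // big1 // => a /zAk/negPf->.
  by rewrite mulr0.
(* The strict inequality at [y] is refuted by comparing coefficients arc by arc. *)
move: lt_u; rewrite ltNge => /negP; apply; apply: ler_sum => a aA.
apply: ler_wpM2l; first by rewrite mulr_ge0 ?ler0n // ltW // net_cap_gt0.
have [aAk | _] := boolP (a \in Ak); last exact: u_ge0.
exact: (dual_feasible_ge1 hAk feas u0).
Qed.
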